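(* Let $X$ be a uniform (i.e. $\infty$-homogeneous) and finite quandle. Then either $X\cong R_3$ or $X$ is trivial.
   Context: A quandle is a set $X$ with a binary operation $\triangleright$ such that (1) $x\triangleright x=x$ for all $x$; (2) for every $y$ the map $x\mapsto x\triangleright y$ is bijective; (3) $(x\triangleright y)\triangleright z=(x\triangleright z)\triangleright(y\triangleright z)$ for all $x,y,z$. A quandle is trivial if $x\triangleright y=x$ for all $x,y$. $R_3$ is the dihedral quandle $\mathbb{Z}/3\mathbb{Z}$ with $x\triangleright y=2y-x$. $\mathrm{Aut}(X)$ is the group of bijective quandle homomorphisms $X\to X$. For $n\in\mathbb{N}$, let $d_n(X)$ be the number of orbits of $X^n$ under the diagonal action of $\mathrm{Aut}(X)$; equivalently, the number of isomorphism classes of $n$-pointed quandles $(X,x_1,\dots,x_n)$ with underlying quandle $X$ (an isomorphism of pointed quandles being a quandle isomorphism that maps the $i$-th basepoint to the $i$-th basepoint). Define numbers $d_{m,n,k}$ for $m,n\in\mathbb{N}$, $k\in\mathbb{N}\cup\{\infty\}$, $m\le k$, recursively by $d_{m,0,k}=1$ and, for $n\ge1$, $d_{m,n,k}=m\,d_{m,n-1,k}+d_{m+1,n-1,k}$ if $m<k$, and $d_{m,n,k}=m\,d_{m,n-1,k}$ if $m=k$. (The number $d_{0,n,|X|}$ is the number of orbits of $X^n$ under the diagonal action of the full symmetric group of $X$.) A quandle $X$ is $n$-homogeneous if $d_n(X)=d_{0,n,|X|}$, and it is uniform, or $\infty$-homogeneous, if it is $n$-homogeneous for all $n\in\mathbb{N}$.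 *)

(* Defs.v *)
From HB Require Import structures.
From mathcomp Require Import all_boot all_fingroup all_algebra primitive_action.
From mathcomp Require Import ring.

Set Implicit Arguments.
Unset Strict Implicit.
Unset Printing Implicit Defensive.

Import GRing.Theory.

Declare Scope quandle_scope.
Open Scope quandle_scope.

HB.mixin Record isQuandle (X : Type) := {
  qop : X -> X -> X;
  qopxx : forall x : X, qop x x = x;
  qop_bij : forall y : X, bijective (fun x => qop x y);
  qopD : forall x y z : X, qop (qop x y) z = qop (qop x z) (qop y z)
}.

#[short(type="quandleType")]
HB.structure Definition Quandle := {X of isQuandle X}.

#[short(type="finQuandleType")]
HB.structure Definition FinQuandle := {X of isQuandle X & Finite X}.

Notation "x ▷ y" := (qop x y) (at level 40, left associativity) : quandle_scope.

Definition trivial_quandle (X : quandleType) : Prop :=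
  forall x y : X, x ▷ y = x.

Definition quandle_isomorphic (X Y : quandleType) : Prop :=
  exists2 f : X -> Y, bijective f & {morph f : x y / x ▷ y}.

Definition dihedral3 : Type := 'Z_3.

HB.instance Definition _ := Finite.on dihedral3.

Section DihedralThree.

Definition dihedral3_op (x y : dihedral3) : dihedral3 :=
  ((2%:R : 'Z_3) * (y : 'Z_3) - (x : 'Z_3))%R.

Lemma dihedral3_opxx x : dihedral3_op x x = x.
Proof. by rewrite /dihedral3_op mulr_natl mulr2n addrK. Qed.

Lemma dihedral3_op_bij y : bijective (fun x => dihedral3_op x y).
Proof. by apply: inv_bij => x; rewrite /dihedral3_op subKr. Qed.

Lemma dihedral3_opD x y z :
  dihedral3_op (dihedral3_op x y) z =
  dihedral3_op (dihedral3_op x z) (dihedral3_op y z).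
Proof. by rewrite /dihedral3_op; ring. Qed.

HB.instance Definition _ :=
  isQuandle.Build dihedral3 dihedral3_opxx dihedral3_op_bij dihedral3_opD.

End DihedralThree.

Section Automorphisms.

Variable X : finQuandleType.

Definition qAut : {set {perm X}} :=
  [set s : {perm X} | [forall x, forall y, s (x ▷ y) == s x ▷ s y]].

Lemma qAutP (s : {perm X}) :
  reflect {morph s : x y / x ▷ y} (s \in qAut).
Proof.
rewrite inE; apply: (iffP forallP) => [h x y | h x].
  by move/forallP: (h x) => /(_ y) /eqP.
by apply/forallP => y; rewrite h.
Qed.

Lemma qAut_group_set : group_set qAut.
Proof.
apply/group_setP; split=> [|s t /qAutP hs /qAutP ht].
  by apply/qAutP => x y; rewrite !perm1.
by apply/qAutP => x y; rewrite !permM hs ht.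
Qed.

Canonical qAut_group := Group qAut_group_set.

(* ['P * n] is the diagonal action of permutations on n-tuples. *)
Definition d_orbits (n : nat) : nat :=
  #|orbit ('P * n)%act qAut @: [set: n.-tuple X]|.

End Automorphisms.

(* Elements of N \cup {oo} are encoded in [option nat], [None] being oo. *)
Definition lt_inf (m : nat) (k : option nat) : bool :=
  if k is Some k' then m < k' else true.

(* Only the values for m <= k are meaningful: the recursion never leaves
   this range, and for m > k the value is irrelevant. *)
Fixpoint d_rec (m n : nat) (k : option nat) : nat :=
  if n is n'.+1 then
    if lt_inf m k then m * d_rec m n' k + d_rec m.+1 n' k
    else m * d_rec m n' k
  else 1.

Definition homogeneous (n : nat) (X : finQuandleType) : Prop :=
  d_orbits X n = d_rec 0 n (Some #|X|).

Definition uniform (X : finQuandleType) : Prop :=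
  forall n : nat, homogeneous n X.

(* Main.v *)
Require Import Defs.
From mathcomp Require Import all_boot.
From mathcomp Require Import all_fingroup primitive_action.

(** Uniformity forces every permutation of [X] to be an automorphism, and a
    finite quandle with that much symmetry is trivial or has three elements.

    For the first claim, the recursion defining [d_rec 0 n (Some #|X|)] counts
    the restricted growth words of length [n]: at each position one either
    repeats one of the [m] letters already used, or takes the next unused letter
    of a fixed enumeration of [X].  Two distinct such words are never related by
    a permutation of [X] (at the first difference, a permutation relating them
    would already fix all the letters used).  If the number of orbits of
    [Aut X] on [X^n] equals the number of these words, they therefore form a
    transversal for [Aut X], so that tuples related by some permutation are
    related by an automorphism.  Applied to a tuple listing the whole of [X],
    this shows that the permutation is itself that automorphism
    ([full_of_card_orbits]).

    For the second claim, suppose [a ▷ b != a].  The element [a ▷ b] is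
    different from [a] and [b], and is fixed by every automorphism fixing
    [a] and [b]; transpositions leave no room for a fourth element.  By
    2-transitivity, [x ▷ y] is then the third element for all distinct [x] and
    [y], which is the multiplication of the dihedral quandle on three points,
    where [x + y + z = 0] for distinct [x], [y], [z]. *)

Set Implicit Arguments.
Unset Strict Implicit.
Unset Printing Implicit Defensive.

Import GroupScope.

Section RestrictedGrowth.

Variables (T : finType) (x0 : T).

Local Notation letter := (nth x0 (enum T)).

(** The parameter [m] is the number of letters already used by the prefix that
    these words continue.  For [m = 0], they are normal forms for the partitions
    of the [n] positions into at most [#|T|] blocks: blocks receive the letters
    of [enum T] in their order of appearance. *)
Fixpoint growth_words (m n : nat) : seq (seq T) :=
  if n is n'.+1 then
    [seq x :: s | x <- take m (enum T), s <- growth_words m n'] ++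
    (if m < #|T| then [seq letter m :: s | s <- growth_words m.+1 n'] else [::])
  else [:: [::]].

Lemma size_growth_words m n :
  m <= #|T| -> size (growth_words m n) = d_rec m n (Some #|T|).
Proof.
elim: n m => [|n IHn] m le_mT //=; rewrite size_cat size_allpairs.
rewrite size_takel -?cardE // IHn //.
by case: ltnP => lt_mT; rewrite ?size_map ?IHn ?addn0.
Qed.

Lemma size_mem_growth_words m n s : s \in growth_words m n -> size s = n.
Proof.
elim: n m s => [|n IHn] m s /=; first by rewrite inE => /eqP ->.
rewrite mem_cat => /orP[/allpairsP[[x t] /= [_ /IHn <- ->]] //|].
by case: ifP => // _ /mapP[t /IHn <- ->].
Qed.

Lemma letter_notin_take m : m < #|T| -> letter m \notin take m (enum T).
Proof.
move=> lt_mT; have := take_uniq m.+1 (enum_uniq T).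
by rewrite (take_nth x0) -?cardE // rcons_uniq => /andP[].
Qed.

Lemma uniq_growth_words m n : uniq (growth_words m n).
Proof.
elim: n m => [|n IHn] m //=; rewrite cat_uniq; apply/and3P; split.
- apply: allpairs_uniq => //; first exact: take_uniq (enum_uniq T).
  by move=> [x s] [y t] _ _ /= [-> ->].
- case: ifP => // lt_mT; apply/hasPn => _ /mapP[s _ ->].
  apply/negP => /allpairsP[[x t] /= [x_old _ [eq_x _]]].
  by move: (letter_notin_take lt_mT); rewrite eq_x x_old.
- by case: ifP => // _; rewrite map_inj_uniq // => s t [].
Qed.

(** A permutation fixing the letters used so far sends a repeated letter to
    itself and, by injectivity, a new letter to a new letter; both words then
    have the same next letter and the permutation fixes one more. *)
Lemma growth_words_rigid (p : {perm T}) m n s t :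
    {in take m (enum T), forall x, p x = x} ->
    s \in growth_words m n -> t \in growth_words m n -> map p s = t ->
  s = t.
Proof.
elim: n m s t => [|n IHn] m s t fix_p /=; first by rewrite !inE => /eqP-> /eqP->.
rewrite !mem_cat => /orP[/allpairsP[[x s'] /= [xm s'_in ->]]|].
  move=> /orP[/allpairsP[[y t'] /= [_ t'_in ->]] [<- eq_t]|].
    by rewrite fix_p // (IHn m s' t').
  case: ifP => // lt_mT /mapP[t' _ ->] [eq_x _].
  by case/negP: (letter_notin_take lt_mT); rewrite -eq_x fix_p.
case: ifP => // lt_mT /mapP[s' s'_in ->].
move=> /orP[/allpairsP[[y t'] /= [ym t'_in ->]] [eq_y _]|].
  case/negP: (letter_notin_take lt_mT).
  suff -> : letter m = y by [].
  by apply: (@perm_inj _ p); rewrite eq_y fix_p.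
move=> /mapP[t' t'_in ->] [fix_m eq_t]; rewrite (IHn m.+1 s' t') // => x.
by rewrite (take_nth x0) -?cardE // mem_rcons inE => /orP[/eqP->|/fix_p].
Qed.

End RestrictedGrowth.

Section OrbitCount.

Variables (T : finType) (G : {group {perm T}}) (n : nat).

Hypothesis card_orbits :
  #|orbit ('P * n)%act G @: [set: n.-tuple T]| = d_rec 0 n (Some #|T|).

Let to := ('P * n)%act : {action {perm T} &-> n.-tuple T}.

(** The growth words lie in distinct [G]-orbits and there are as many of them
    as orbits, so every tuple is [G]-equivalent to one of them; rigidity
    then identifies the words attached to [u] and to its image under [p]. *)
Lemma orbit_of_card_orbits (p : {perm T}) (u : n.-tuple T) :
  to u p \in orbit to G u.
Proof.
case: (pickP T) => [x0 _ | T0]; last first.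
  suff -> : to u p = u by apply: orbit_refl.
  by apply: eq_from_tnth => i; have := T0 (tnth u i).
pose L := [set t : n.-tuple T | tval t \in growth_words x0 0 n].
have rigid (q : {perm T}) s t : s \in L -> t \in L -> to s q = t -> s = t.
  rewrite !inE => sL tL eq_t; apply/val_inj.
  apply: (@growth_words_rigid _ x0 q 0 n) => //; first by rewrite take0.
  by rewrite -eq_t.
have inj_orbit : {in L &, injective (orbit to G)}.
  move=> s t sL tL eq_st; have: t \in orbit to G s by rewrite eq_st orbit_refl.
  by case/orbitP => q _; apply: rigid.
have cardL : #|L| = d_rec 0 n (Some #|T|).
  rewrite -(size_growth_words x0) // cardE -(size_map val).
  apply/perm_size/uniq_perm; rewrite ?uniq_growth_words //.
    by rewrite (map_inj_uniq val_inj) enum_uniq.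
  move=> s; apply/mapP/idP => [[t] | sL]; first by rewrite mem_enum inE => tL ->.
  have sz_s := size_mem_growth_words sL.
  by exists (tcast sz_s (in_tuple s)); rewrite ?mem_enum ?inE /= ?val_tcast.
have orbitsL : orbit to G @: L = orbit to G @: [set: n.-tuple T].
  apply/eqP; rewrite eqEcard imsetS ?subsetT //=.
  by rewrite (card_in_imset inj_orbit) cardL card_orbits.
have rep t : exists2 l, l \in L & exists2 g, g \in G & to l g = t.
  have: orbit to G t \in orbit to G @: L by rewrite orbitsL imset_f.
  case/imsetP => l lL eq_tl; exists l => //.
  by apply/orbitP; rewrite -eq_tl orbit_refl.
have [l lL [g gG def_u]] := rep u.
have [l' l'L [g' g'G def_pu]] := rep (to u p).
have eq_ll' : l = l'.
  apply: (rigid (g * p * g'^-1)) => //.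
  by rewrite !actM def_u -def_pu actK.
apply/orbitP; exists (g^-1 * g'); first by rewrite groupM ?groupV.
by rewrite actM -{1}def_u actK eq_ll' def_pu.
Qed.

End OrbitCount.

(** A permutation is determined by the image of a tuple listing all of [T]. *)
Lemma full_of_card_orbits (T : finType) (G : {group {perm T}}) :
    #|orbit ('P * #|T|)%act G @: [set: #|T|.-tuple T]|
      = d_rec 0 #|T| (Some #|T|) ->
  forall p, p \in G.
Proof.
move=> card_orbits p.
have := orbit_of_card_orbits card_orbits p (enum_tuple T).
case/orbitP => g gG /(congr1 val) /= /eq_in_map eq_gp.
by suff <- : g = p by []; apply/permP => x; apply: eq_gp; rewrite mem_enum.
Qed.

Section FullySymmetric.

Variable X : finQuandleType.

Hypothesis full : forall (p : {perm X}), {morph p : x y / x ▷ y}.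

Lemma qop_neq_r (x y : X) : x != y -> x ▷ y != y.
Proof.
apply: contraNneq => xy_y; apply/eqP/(bij_inj (qop_bij y)).
by rewrite /= xy_y qopxx.
Qed.

(** By 2-transitivity of the symmetric group, one pair on which [▷] acts
    trivially forces [▷] to be trivial. *)
Lemma qop_neq_l (a b x y : X) : a ▷ b != a -> x != y -> x ▷ y != x.
Proof.
move=> ab_a neq_xy; apply: contra_neq ab_a => xy_x.
have [<- | neq_ab] := eqVneq a b; first exact: qopxx.
pose q := tperm x a; pose p := q * tperm (q y) b.
have px : p x = a.
  rewrite permM tpermL tpermD // 1?eq_sym //.
  by rewrite -(tpermL x a) (inj_eq perm_inj).
have py : p y = b by rewrite permM tpermL.
by rewrite -px -{1}py -full xy_x.
Qed.

Lemma qop_notin2 (a b x y : X) :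
  a ▷ b != a -> x != y -> x ▷ y \notin [set x; y].
Proof.
by move=> ab_a xy; rewrite !inE (negPf (qop_neq_l ab_a xy)) (negPf (qop_neq_r xy)).
Qed.

(** Exchanging [a ▷ b] with a fourth element would be an automorphism fixing
    [a] and [b] but not their product. *)
Lemma card3_of_nontrivial (a b : X) : a ▷ b != a -> #|X| = 3.
Proof.
move=> ab_a.
have neq_ab : a != b by apply: contra_neq ab_a => ->; rewrite qopxx.
have ab_b := qop_neq_r neq_ab.
have <- : #|[set a ▷ b; a; b]| = 3.
  by rewrite -setUA cardsU1 (qop_notin2 ab_a) // cards2 neq_ab.
rewrite -cardsT; congr #|pred_of_set _|; apply/eqP; rewrite eq_sym -subTset.
apply/subsetP => w _; rewrite !inE; apply: contraT.
rewrite !negb_or => /andP[/andP[w_ab w_a] w_b].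
have := full (tperm (a ▷ b) w) a b.
by rewrite tpermL !tpermD // => eq_w; rewrite eq_w eqxx in w_ab.
Qed.

Lemma dihedral3_third (i j k : dihedral3) :
  i != j -> k \notin [set i; j] -> k = i ▷ j.
Proof.
rewrite !inE => neq_ij k_ij; apply/eqP; move: neq_ij k_ij.
by case: i => [[|[|[|i]]] Hi] //; case: j => [[|[|[|j]]] Hj] //;
  case: k => [[|[|[|k]]] Hk].
Qed.

Lemma full_isomorphic_dihedral3 (a b : X) :
  a ▷ b != a -> quandle_isomorphic X dihedral3.
Proof.
move=> ab_a; have card3 := card3_of_nontrivial ab_a.
pose f (x : X) : dihedral3 := cast_ord card3 (enum_rank x).
have bij_f : bijective f.
  apply: inj_card_bij; last by rewrite card3 card_ord.
  by move=> x y /cast_ord_inj/enum_rank_inj.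
have inj_f := bij_inj bij_f; exists f => // x y.
have [-> | xy] := eqVneq x y; first by rewrite !qopxx.
apply: dihedral3_third; first by rewrite (inj_eq inj_f).
by have := qop_notin2 ab_a xy; rewrite !inE !(inj_eq inj_f).
Qed.

End FullySymmetric.

Theorem theorem4p27 (X : finQuandleType) (HX : uniform X) :
  quandle_isomorphic X dihedral3 \/ trivial_quandle X.
Proof.
have full (p : {perm X}) : {morph p : x y / x ▷ y}.
  by apply/qAutP; apply: full_of_card_orbits (HX #|X|) p.
case: (pickP [pred u : X * X | u.1 ▷ u.2 != u.1]) => [[a b] /= ab_a | triv].
  by left; apply: full_isomorphic_dihedral3 ab_a.
by right=> x y; apply/eqP; have /= := triv (x, y); case: eqP.
Qed.
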